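(* Let $G=(V,E)$ be a weighted graph and let $\Omega\subset V$ be a finite nonempty subset with $\delta\Omega$ finite and nonempty and $\widetilde{\Omega}$ connected. Let $\Lambda$ be the Dirichlet-to-Neumann operator on $\Omega$ and $E_1(\Lambda)=\{\varphi\in\mathbb{R}^{\delta\Omega}:\Lambda\varphi=\varphi\}$. Then: (1) For $\varphi\in\mathbb{R}^{\delta\Omega}$, $\varphi\in E_1(\Lambda)$ if and only if $u_\varphi=\overline{\varphi}$, where $u_\varphi$ is the harmonic extension and $\overline{\varphi}$ the null-extension of $\varphi$ to $\overline{\Omega}$. (2) $E_1(\Lambda)=\operatorname{Ker}Q$, where $Q:\mathbb{R}^{\delta\Omega}\to\mathbb{R}^{\delta_I\Omega}$ is the linear operator $$Q\varphi(x)=\frac{1}{m_x}\sum_{y\in\delta\Omega}\mu_{xy}\varphi(y),\qquad x\in\delta_I\Omega.$$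
   Context: $V$ is a countable set and $\mu:V\times V\to[0,\infty)$, $(x,y)\mapsto\mu_{xy}=\mu_{yx}$, is a symmetric weight function; $\{x,y\}\in E$ (written $x\sim y$) iff $\mu_{xy}>0$. Self-loops are allowed. For $\Omega_1,\Omega_2\subset V$, $E(\Omega_1,\Omega_2)=\{\{x,y\}\in E: x\in\Omega_1,y\in\Omega_2\}$. The vertex boundary is $\delta\Omega=\{x\in V\setminus\Omega: x\sim y\text{ for some }y\in\Omega\}$, and $\overline{\Omega}=\Omega\cup\delta\Omega$. Also $\delta_I\Omega=\{x\in\Omega: x\sim y\text{ for some }y\in\delta\Omega\}$. The graph $\widetilde{\Omega}$ has vertex set $\overline{\Omega}$ and edge set $E(\Omega,\overline{\Omega})$. The measure $m:\overline{\Omega}\to(0,\infty)$ is $m_x=\sum_{y\in V,\,y\sim x}\mu_{xy}$ for $x\in\Omega$ and $m_x=\sum_{y\in\Omega,\,y\sim x}\mu_{xy}$ for $x\in\delta\Omega$. For $f:\overline{\Omega}\to\mathbb{R}$: $\Delta f(x)=\frac1{m_x}\sum_{y\sim x}\mu_{xy}(f(y)-f(x))$ for $x\in\Omega$, and $\frac{\partial f}{\partial n}(z)=\frac1{m_z}\sum_{x\in\Omega,\,x\sim z}\mu_{zx}(f(z)-f(x))$ for $z\in\delta\Omega$. For $\varphi:\delta\Omega\to\mathbb{R}$, the harmonic extension $u_\varphi:\overline{\Omega}\to\mathbb{R}$ is the unique function with $\Delta u_\varphi=0$ on $\Omega$ and $u_\varphi=\varphi$ on $\delta\Omega$; the null-extension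 $\overline{\varphi}:\overline{\Omega}\to\mathbb{R}$ equals $\varphi$ on $\delta\Omega$ and $0$ on $\Omega$. The Dirichlet-to-Neumann operator is $\Lambda:\mathbb{R}^{\delta\Omega}\to\mathbb{R}^{\delta\Omega}$, $\Lambda\varphi=\frac{\partial u_\varphi}{\partial n}$. *)

(* Defs.v *)
From HB Require Import structures.
From mathcomp Require Import all_boot all_order all_algebra.
From mathcomp Require Import all_classical all_reals.

Set Implicit Arguments.
Unset Strict Implicit.
Unset Printing Implicit Defensive.

Import Order.TTheory GRing.Theory Num.Theory.

Local Open Scope classical_set_scope.
Local Open Scope ring_scope.

Record weighted_graph (R : realType) (V : countType) := WeightedGraph {
  weight :> V -> V -> R;
  weight_ge0 : forall x y, 0 <= weight x y;
  weight_sym : forall x y, weight x y = weight y x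
}.

Section WeightedGraph.
Context {R : realType} {V : countType}.
Variables (mu : weighted_graph R V) (Omega : set V).

(* Self-loops, i.e. [adj x x], are allowed. *)
Definition adj (x y : V) : bool := 0 < mu x y.

Definition vboundary : set V :=
  [set x | ~ Omega x /\ exists2 y, Omega y & adj x y].

Definition vclosure : set V := Omega `|` vboundary.

Definition inner_boundary : set V :=
  [set x | Omega x /\ exists2 y, vboundary y & adj x y].

(* The adjacency relation of the graph with vertex set [vclosure] and edge set
   E(Omega, vclosure): edges joining two boundary vertices are discarded. *)
Definition tilde_adj (x y : vclosure) : bool :=
  adj (\val x) (\val y) && ((\val x \in Omega) || (\val y \in Omega)).

Definition tilde_connected : Prop :=
  forall x y : vclosure,
    exists2 p : seq vclosure, path tilde_adj x p & last x p = y.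

(* [m_x], extended to all of V; outside [vclosure] it vanishes.  The sums over
   possibly infinite sets below are finitely supported as soon as [Omega] and
   [vboundary] are finite. *)
Definition vmeasure (x : V) : R :=
  if x \in Omega then \sum_(y \in [set y | adj x y]) mu x y
  else \sum_(y \in [set y | Omega y /\ adj x y]) mu x y.

Lemma Omega_vclosure : Omega `<=` vclosure.
Proof. exact: subsetUl. Qed.

Lemma vboundary_vclosure : vboundary `<=` vclosure.
Proof. exact: subsetUr. Qed.

(* Every neighbour of a vertex of [Omega] lies in [vclosure], so that summing
   over [vclosure] is summing over all neighbours of [x] in V. *)
Definition laplacian (f : vclosure -> R) (x : Omega) : R :=
  (vmeasure (\val x))^-1 *
  \sum_(y \in [set y : vclosure | adj (\val x) (\val y)])
    mu (\val x) (\val y) * (f y - f (subfun Omega_vclosure x)).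

Definition normal_derivative (f : vclosure -> R) (z : vboundary) : R :=
  (vmeasure (\val z))^-1 *
  \sum_(x \in [set x : Omega | adj (\val x) (\val z)])
    mu (\val z) (\val x) *
    (f (subfun vboundary_vclosure z) - f (subfun Omega_vclosure x)).

Definition is_harmonic_extension (phi : vboundary -> R) (u : vclosure -> R) :
    Prop :=
  (forall x, laplacian u x = 0) /\
  (forall z, u (subfun vboundary_vclosure z) = phi z).

(* The harmonic extension exists and is unique when [Omega] and [vboundary] are
   finite, [vboundary] is nonempty and [tilde_connected] holds; the default
   value 0 of [xget] is only used when no harmonic extension exists. *)
Definition harmonic_extension (phi : vboundary -> R) : vclosure -> R :=
  xget (fun=> 0) [set u | is_harmonic_extension phi u].

Definition null_extension (phi : vboundary -> R) (x : vclosure) : R :=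
  if pselect (vboundary (\val x)) is left xb then phi (SigSub (mem_set xb))
  else 0.

Definition DtN (phi : vboundary -> R) : vboundary -> R :=
  normal_derivative (harmonic_extension phi).

Definition E1 : set (vboundary -> R) := [set phi | DtN phi = phi].

Definition Qop (phi : vboundary -> R) (x : inner_boundary) : R :=
  (vmeasure (\val x))^-1 *
  \sum_(y \in [set: vboundary]) mu (\val x) (\val y) * phi y.

End WeightedGraph.

Arguments vclosure {R V} mu Omega.
Arguments vmeasure {R V} mu Omega x.
Arguments laplacian {R V} mu Omega f x.
Arguments normal_derivative {R V} mu Omega f z.
Arguments is_harmonic_extension {R V} mu Omega phi u.
Arguments harmonic_extension {R V} mu Omega phi.
Arguments null_extension {R V} mu Omega phi x.
Arguments DtN {R V} mu Omega phi.
Arguments E1 {R V} mu Omega.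
Arguments Qop {R V} mu Omega phi x.

(* Main.v *)
Require Import Defs.
From mathcomp Require Import all_boot all_order all_algebra.
From mathcomp Require Import all_classical all_reals.
From mathcomp Require Import finmap ring lra.

(* Write [w] for the harmonic extension cut off to [Omega].  At a boundary vertex
   the normal derivative is [phi z] minus the average of [w] over the neighbours
   of [z] in [Omega], so [phi] is in [E_1] exactly when these averages vanish.
   In that case pairing harmonicity with [w] leaves minus the Dirichlet energy of
   [w], which is thus zero; as [w] vanishes on the boundary and the graph is
   connected, [w = 0].  The same energy argument gives uniqueness for the
   Dirichlet problem, hence existence by finite dimension, and the null-extension
   of [phi] is harmonic exactly when [Q phi = 0]. *)

Import Order.TTheory GRing.Theory Num.Theory.
Local Open Scope classical_set_scope.
Local Open Scope ring_scope.

(** * Finite linear systems and the Dirichlet energy *)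

(** A square matrix with trivial kernel is invertible. Vectors are functions supported on [s], so
    the type [T] may be infinite. *)
Lemma injective_system_solvable (F : fieldType) (T : eqType) (s : seq T)
    (a : T -> T -> F) :
  uniq s ->
  (forall w : T -> F, (forall x, x \notin s -> w x = 0) ->
     (forall x, x \in s -> \sum_(y <- s) a x y * w y = 0) ->
     forall x, x \in s -> w x = 0) ->
  forall b : T -> F, exists w : T -> F,
    (forall x, x \notin s -> w x = 0) /\
    (forall x, x \in s -> \sum_(y <- s) a x y * w y = b x).
Proof.
move=> us inj b; pose t := in_tuple s; pose n := size s.
pose A : 'M[F]_n := \matrix_(i, j) a (tnth t j) (tnth t i).
(* A row read as a function on [T]: the sum has at most one term, as [s] has no repetition, and none
   off [s]. *)
pose W (v : 'rV[F]_n) x := \sum_(i < n | tnth t i == x) v 0 i.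
have tnth_inj : injective (tnth t) by apply/tuple_uniqP.
have Wt v i : W v (tnth t i) = v 0 i.
  by rewrite /W (eq_bigl (pred1 i)) ?big_pred1_eq// => j /=; rewrite inj_eq.
have Wout v x : x \notin s -> W v x = 0.
  move=> xs; rewrite /W big_pred0// => i; apply/negP => /eqP xE.
  by move: xs; rewrite -xE (mem_tnth i t).
have WA v i : \sum_(y <- s) a (tnth t i) y * W v y = (v *m A) 0 i.
  rewrite -[X in \sum_(y <- X) _]/(tval t) big_tuple mxE; apply: eq_bigr => j _.
  by rewrite Wt mxE mulrC.
have tP x : x \in s -> exists i, x = tnth t i.
  by move=> xs; apply/tnthP.
have Au : A \in unitmx.
  rewrite -row_free_unit -kermx_eq0; apply/eqP/row_matrixP => i.
  have /sub_kermxP kA : (row i (kermx A) <= kermx A)%MS by exact: row_sub.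
  move: (row i _) kA => v kA; rewrite row0; apply/rowP => j.
  rewrite mxE -Wt; apply: inj; [exact: Wout| |exact: mem_tnth].
  by move=> x /tP[k ->]; rewrite WA kA mxE.
exists (W ((\row_i b (tnth t i)) *m invmx A)); split; first exact: Wout.
by move=> x /tP[i ->]; rewrite WA mulmxKV// mxE.
Qed.

(** Swapping the summation variables gives a second expression of the left-hand side; the two add up
    to minus the full double sum of squares, whence the factor one half. *)
Lemma green_formula (R : realFieldType) (T : eqType) (s : seq T)
    (c : T -> T -> R) (w : T -> R) : (forall x y, c x y = c y x) ->
  \sum_(x <- s) w x * (\sum_(y <- s) c x y * (w y - w x)) =
  - (2^-1 * \sum_(x <- s) \sum_(y <- s) c x y * (w y - w x) ^+ 2).
Proof.
move=> csym; under eq_bigr do rewrite mulr_sumr.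
set S := LHS.
have SE : S = \sum_(x <- s) \sum_(y <- s) w y * (c x y * (w x - w y)).
  by rewrite /S exchange_big; do 2!apply: eq_bigr => ? _; rewrite csym.
suff -> : \sum_(x <- s) \sum_(y <- s) c x y * (w y - w x) ^+ 2 = - (S + S).
  by field.
rewrite {1}SE /S -big_split -sumrN; apply: eq_bigr => x _ /=.
rewrite -big_split -sumrN; apply: eq_bigr => y _ /=.
by ring.
Qed.

(** By Green's formula the energy is at most zero, while all its terms are nonnegative; so each term
    vanishes. *)
Lemma energy_le0_edge_eq (R : realFieldType) (T : eqType) (s : seq T)
    (c : T -> T -> R) (w : T -> R) : (forall x y, c x y = c y x) ->
  (forall x y, 0 <= c x y) ->
  0 <= \sum_(x <- s) w x * (\sum_(y <- s) c x y * (w y - w x)) ->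
  forall x y, x \in s -> y \in s -> 0 < c x y -> w x = w y.
Proof.
move=> csym c0; rewrite green_formula// => wge x y xs ys cxy.
have t0 u v : 0 <= c u v * (w v - w u) ^+ 2 by rewrite mulr_ge0// sqr_ge0.
have : \sum_(u <- s) \sum_(v <- s) c u v * (w v - w u) ^+ 2 == 0.
  rewrite eq_le sumr_ge0 ?andbT; last by move=> u _; apply: sumr_ge0.
  by move: wge; set e := \sum_(u <- s) _; lra.
rewrite psumr_eq0; last by move=> u _; apply: sumr_ge0.
move=> /allP/(_ x xs)/=; rewrite psumr_eq0// => /allP/(_ y ys)/=.
by rewrite mulf_eq0 gt_eqF//= sqrf_eq0 subr_eq0 => /eqP.
Qed.

(** * From functions on subset types to functions on the ambient type *)

(** Lets later arguments work with functions on all of [V], which can be cut off and summed over any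
    finite subset. *)
Lemma set_type_fun_extends (T : choiceType) (R : nmodType) (A : set T)
  (f : A -> R) : exists F : T -> R, f = F \o val.
Proof.
exists (fun v => oapp f 0 (insub v)).
by apply/funext => a /=; rewrite valK.
Qed.

Lemma fsbig_set_type (T : choiceType) (R : nmodType) (A B : set T) (F : T -> R) :
  \sum_(y \in [set y : A | B (val y)]) F (val y) = \sum_(y \in A `&` B) F y.
Proof.
rewrite -(fsbig_image _ (val : A -> T)); last by move=> x y _ _; exact: val_inj.
congr (\big[_/_]_(_ \in _) _); apply/seteqP; split => [_ [y By <-]|y [Ay By]].
  by split => //; exact: set_valP.
by exists (SigSub (mem_set Ay)).
Qed.

Lemma big_fset_set_sub (T : choiceType) (R : nmodType) (A B : set T)
    (F : T -> R) : finite_set B -> A `<=` B ->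
  (forall x, B x -> ~ A x -> F x = 0) ->
  \sum_(y <- fset_set A) F y = \sum_(y <- fset_set B) F y.
Proof.
move=> fB AB F0; have fA := sub_finite_set AB fB.
by rewrite -!fsbig_finite//; apply: fsbig_widen => // x [Bx nAx]; exact: F0.
Qed.

(** * Unnormalised forms of the Laplacian and of the normal derivative *)

Section Graph.
Context {R : realType} {V : countType}.
Variables (mu : weighted_graph R V) (Omega : set V).
Local Notation bd := (vboundary mu Omega).
Local Notation cl := (vclosure mu Omega).

Lemma adj_sym x y : adj mu x y = adj mu y x.
Proof. by rewrite /adj weight_sym. Qed.

Lemma weight_nadj x y : ~ adj mu x y -> mu x y = 0.
Proof.
by move=> /negP; rewrite /adj lt_def weight_ge0 andbT negbK => /eqP.
Qed.

Lemma sum_adj (A : set V) (x : V) (F : V -> R) : finite_set A ->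
  \sum_(y \in [set y : A | adj mu x (val y)]) mu x (val y) * F (val y) =
  \sum_(y <- fset_set A) mu x y * F y.
Proof.
move=> fA.
rewrite (fsbig_set_type _ _ A [set y | adj mu x y] (fun y => mu x y * F y)).
rewrite -fsbig_finite//; apply: fsbig_widen => [y []//|y [Ay nA]] /=.
by rewrite weight_nadj ?mul0r// => xy; apply: nA.
Qed.

Lemma bd_notin (z : bd) : ~ Omega (val z).
Proof. by have [] := set_valP z. Qed.

Lemma bd_vmeasure (z : bd) : finite_set Omega ->
  vmeasure mu Omega (val z) = \sum_(x <- fset_set Omega) mu (val z) x.
Proof.
move=> fO; rewrite /vmeasure memNset; last exact: bd_notin.
rewrite -fsbig_finite//; apply: fsbig_widen => [y []//|y [Oy nA]] /=.
by rewrite weight_nadj// => zy; apply: nA.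
Qed.

Lemma bd_vmeasure_neq0 (z : bd) : finite_set Omega ->
  vmeasure mu Omega (val z) != 0.
Proof.
move=> fO; rewrite bd_vmeasure// psumr_eq0; last by move=> *; exact: weight_ge0.
have [_ [y Oy zy]] := set_valP z.
by apply/allPn; exists y; rewrite /= ?in_fset_set ?mem_set// gt_eqF.
Qed.

Lemma neighbour_vclosure x y : Omega x -> adj mu x y -> cl y.
Proof.
move=> Ox xy; have [|nO] := pselect (Omega y); [by left|right].
by split => //; exists x => //; rewrite adj_sym.
Qed.

Hypotheses (Ofin : finite_set Omega) (bfin : finite_set bd).

Lemma vclosure_finite : finite_set cl.
Proof. by rewrite finite_setU. Qed.

Lemma Omega_vmeasure x : Omega x ->
  vmeasure mu Omega x = \sum_(y <- fset_set cl) mu x y.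
Proof.
move=> Ox; rewrite /vmeasure mem_set//.
rewrite -(fsbig_finite _ _ vclosure_finite).
apply: fsbig_widen => [y|y [_ /weight_nadj//]].
exact: neighbour_vclosure.
Qed.

(* If [m_x = 0], then all weights at [x] vanish, and so do both sides. *)
Lemma vmeasure_inv_eq0 (x : V) (F : V -> R) (A : set V) : Omega x -> A `<=` cl ->
  (vmeasure mu Omega x)^-1 * (\sum_(y <- fset_set A) mu x y * F y) = 0 <->
  \sum_(y <- fset_set A) mu x y * F y = 0.
Proof.
move=> Ox Acl; split => [/eqP|->]; last by rewrite mulr0.
rewrite mulf_eq0 invr_eq0 => /orP[|/eqP//].
rewrite Omega_vmeasure// psumr_eq0 => [/allP m0|*]; last exact: weight_ge0.
have fA := sub_finite_set Acl vclosure_finite.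
rewrite big_seq big1// => y; rewrite in_fset_set// => /set_mem/Acl cly.
rewrite (eqP (m0 y _)) ?mul0r//=.
by rewrite in_fset_set ?mem_set//; exact: vclosure_finite.
Qed.

(** The Laplacian without the factor [1/m_x], summed over the whole closure so that its kernel is
    symmetric, as Green's formula requires. *)
Definition flux (U : V -> R) x := \sum_(y <- fset_set cl) mu x y * (U y - U x).

Lemma laplacian_eq0 (U : V -> R) (x : Omega) :
  laplacian mu Omega (U \o val) x = 0 <-> flux U (val x) = 0.
Proof.
rewrite /laplacian /= (sum_adj _ _ (fun y => U y - U (val x))); last first.
  exact: vclosure_finite.
by apply: vmeasure_inv_eq0 => //; exact: set_valP.
Qed.

Lemma is_harmonic_extensionP (phi : bd -> R) (U : V -> R) :
  is_harmonic_extension mu Omega phi (U \o val) <->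
  (forall x, Omega x -> flux U x = 0) /\ (forall z : bd, U (val z) = phi z).
Proof.
split => -[h b]; split => //= x; last exact/laplacian_eq0/h/set_valP.
move=> Ox; have /laplacian_eq0 := h (SigSub (mem_set Ox)).
by [].
Qed.

(** Since [m_z] is the total weight from [z] to [Omega] and is nonzero, the normal derivative is
    [U z] minus the weighted mean of [U] over the neighbours of [z] in [Omega]. *)
Lemma normal_derivative_eq (U : V -> R) (z : bd) :
  normal_derivative mu Omega (U \o val) z = U (val z) <->
  \sum_(x <- fset_set Omega) mu (val z) x * U x = 0.
Proof.
rewrite /normal_derivative /=.
under eq_fsbigl do under eq_set do rewrite adj_sym.
rewrite (sum_adj Omega (val z) (fun x => U (val z) - U x))//.
have := bd_vmeasure_neq0 z Ofin.
have -> : \sum_(x <- fset_set Omega) mu (val z) x * (U (val z) - U x) =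
    vmeasure mu Omega (val z) * U (val z) -
    \sum_(x <- fset_set Omega) mu (val z) x * U x.
  rewrite bd_vmeasure// mulr_suml -sumrB.
  by apply: eq_bigr => x _; rewrite mulrBr.
move: (vmeasure _ _ _) => m m0; rewrite mulrBr mulKf//; split => [/eqP|->].
  rewrite -subr_eq0 addrAC subrr sub0r oppr_eq0 mulf_eq0 invr_eq0 (negPf m0).
  by move/eqP.
by rewrite mulr0 subr0.
Qed.

(** * Uniqueness and existence for the Dirichlet problem *)

Hypotheses (bd0 : bd !=set0) (conn : tilde_connected mu Omega).

(** The energy of [w] vanishes, so [w] is constant along edges; a path leads from [x] to a boundary
    vertex, where [w] is zero. *)
Lemma flux_pairing_ge0_eq0 (w : V -> R) : (forall x, ~ Omega x -> w x = 0) ->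
  0 <= \sum_(x <- fset_set cl) w x * flux w x ->
  forall x, cl x -> w x = 0.
Proof.
move=> w0 wge x clx; have fcl := vclosure_finite.
have edge (y y' : cl) : tilde_adj y y' -> w (val y) = w (val y').
  move=> /andP[yy' _]; apply: (energy_le0_edge_eq _ _ (fset_set cl) mu) => //.
  - exact: weight_sym.
  - exact: weight_ge0.
  - by rewrite in_fset_set//; exact: valP.
  - by rewrite in_fset_set//; exact: valP.
have [z bz] := bd0.
pose z' : cl := SigSub (mem_set (vboundary_vclosure bz)).
have [p pp zp] := conn (SigSub (mem_set clx)) z'.
suff wp : forall (p : seq cl) (y : cl), path (@tilde_adj _ _ mu Omega) y p ->
    w (val (last y p)) = w (val y).
  have := wp _ _ pp; rewrite zp /= => <-.
  by apply: w0; have [] := bz.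
by elim=> //= y' q ih y /andP[/edge -> /ih].
Qed.

Lemma flux_unique (U1 U2 : V -> R) :
  (forall x, Omega x -> flux U1 x = flux U2 x) -> (forall z, bd z -> U1 z = U2 z) ->
  forall x, cl x -> U1 x = U2 x.
Proof.
move=> h b x clx; pose w v := if v \in Omega then U1 v - U2 v else 0.
have wcl v : cl v -> w v = U1 v - U2 v.
  rewrite /w; case: ifPn => //; rewrite notin_setE => nO [//|bv].
  by rewrite b// subrr.
apply/subr0_eq; rewrite -wcl//; apply: flux_pairing_ge0_eq0 => //.
  by move=> v nO; rewrite /w memNset.
rewrite big_seq big1// => v; rewrite in_fset_set; last exact: vclosure_finite.
move=> /set_mem clv; have [Ov|nO] := pselect (Omega v); last first.
  by rewrite {1}/w memNset// mul0r.
suff -> : flux w v = flux U1 v - flux U2 v by rewrite h// subrr mulr0.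
rewrite /flux -sumrB; apply: eq_big_seq => y.
rewrite in_fset_set; last exact: vclosure_finite.
by move=> /set_mem cly; rewrite !wcl//; ring.
Qed.

Lemma fluxD (f g : V -> R) x : flux (f \+ g) x = flux f x + flux g x.
Proof. by rewrite /flux -big_split; apply: eq_bigr => y _ /=; ring. Qed.

Lemma flux_at_zero (f : V -> R) x : f x = 0 ->
  flux f x = \sum_(y <- fset_set cl) mu x y * f y.
Proof. by move=> fx; apply: eq_bigr => y _; rewrite fx subr0. Qed.

(** The solution is sought as [w + psi], with [psi] the data set to zero on [Omega] and [w]
    supported in [Omega]. This is a square system indexed by [Omega], injective by [flux_unique]. *)
Lemma dirichlet_problem_solvable (phi : V -> R) :
  exists U : V -> R, (forall x, Omega x -> flux U x = 0) /\
    (forall z, bd z -> U z = phi z).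
Proof.
pose s := fset_set Omega.
have sP x : (x \in s) = (x \in Omega) by rewrite in_fset_set.
have sO x : x \in s -> Omega x by rewrite sP => /set_mem.
pose deg x := \sum_(y <- fset_set cl) mu x y.
(* The matrix of [flux] on functions supported in [Omega]; its diagonal keeps the degree in the
   whole closure. *)
pose a x y := mu x y - (x == y)%:R * deg x.
have aE w x : (forall y, y \notin s -> w y = 0) -> x \in s ->
    \sum_(y <- s) a x y * w y = flux w x.
  move=> w0 xs; rewrite /flux.
  under [RHS]eq_bigr do rewrite mulrBr; rewrite sumrB -mulr_suml.
  under eq_bigr do rewrite mulrBl; rewrite sumrB; congr (_ - _).
    apply: big_fset_set_sub; [exact: vclosure_finite|exact: Omega_vclosure|].
    by move=> y _ nO; rewrite w0 ?mulr0// sP memNset.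
  rewrite (bigD1_seq x)//= eqxx mul1r big1 ?addr0// => y yx.
  by rewrite eq_sym (negPf yx) !mul0r.
pose psi v := if v \in Omega then 0 else phi v.
have [|w [w0 wE]] :=
  injective_system_solvable _ _ s a (fset_uniq _) _ (fun x => - flux psi x).
  move=> w w0 wE x xs; apply: (flux_unique w (fun=> 0)); last by left; exact: sO.
    move=> y Oy; rewrite -aE// ?wE ?sP ?mem_set//.
    by rewrite /flux big1// => ? _; rewrite subrr mulr0.
  by move=> z [nO _]; rewrite w0// sP memNset.
exists (w \+ psi); split => [x Ox|z [nO _] /=].
  by rewrite fluxD -aE ?wE ?addNr// sP mem_set.
by rewrite w0 ?sP ?memNset// add0r /psi memNset.
Qed.

Lemma harmonic_extension_is_harmonic (phi : bd -> R) :
  is_harmonic_extension mu Omega phi (harmonic_extension mu Omega phi).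
Proof.
have [Phi phiE] := set_type_fun_extends _ _ _ phi.
have [U [h b]] := dirichlet_problem_solvable Phi.
apply: xgetPex.
exists (U \o val); apply/is_harmonic_extensionP; split => // z.
by rewrite b ?phiE//; exact: set_valP.
Qed.

Lemma harmonic_extension_eq (phi : bd -> R) u :
  is_harmonic_extension mu Omega phi u -> harmonic_extension mu Omega phi = u.
Proof.
have := harmonic_extension_is_harmonic phi.
have [U ->] := set_type_fun_extends _ _ _ u.
have [W ->] := set_type_fun_extends _ _ _ (harmonic_extension mu Omega phi).
move=> /is_harmonic_extensionP[hW bW] /is_harmonic_extensionP[hU bU].
apply/funext => x /=; apply: flux_unique; last exact: set_valP.
  by move=> y Oy; rewrite hW ?hU.
move=> z bz; pose z' : bd := SigSub (mem_set bz).
by rewrite -[z]/(val z') bW bU.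
Qed.

(** * The eigenspace and the kernel of [Q] *)

Lemma null_extensionE (phi : bd -> R) (Phi : V -> R) : phi = Phi \o val ->
  null_extension mu Omega phi = (fun v => if v \in Omega then 0 else Phi v) \o val.
Proof.
move=> ->; apply/funext => x; rewrite /null_extension /=.
case: pselect => [[nO _]|nb] /=; first by rewrite memNset.
by have [Ox|//] := set_valP x; rewrite mem_set.
Qed.

Lemma E1P (phi : bd -> R) : E1 mu Omega phi <->
  harmonic_extension mu Omega phi = null_extension mu Omega phi.
Proof.
have [Phi phiE] := set_type_fun_extends _ _ _ phi.
pose psi v := if v \in Omega then 0 else Phi v.
have psiE : null_extension mu Omega phi = psi \o val := null_extensionE _ _ phiE.
rewrite /E1 /DtN /=; have := harmonic_extension_is_harmonic phi.
have [U ->] := set_type_fun_extends _ _ _ (harmonic_extension mu Omega phi).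
move=> /is_harmonic_extensionP[hU bU]; split => [e1|UE]; last first.
  (* If [U] is the null-extension, it vanishes on [Omega], and so do all boundary sums. *)
  apply/funext => z; rewrite -bU; apply/normal_derivative_eq.
  rewrite big_seq big1// => x; rewrite in_fset_set// => Ox.
  pose x' : cl := SigSub (mem_set (Omega_vclosure mu (set_mem Ox))).
  have -> : U x = null_extension mu Omega phi x' by rewrite -UE.
  by rewrite psiE /= /psi Ox mulr0.
have {e1} e1 z : bd z -> \sum_(x <- fset_set Omega) mu z x * U x = 0.
  move=> bz; pose z' : bd := SigSub (mem_set bz).
  by apply/(normal_derivative_eq U z'); rewrite e1 bU.
(* Splits [U] into its part [w] on [Omega] and the rest [chi]; the aim is [w = 0] on the closure. *)
pose w v := if v \in Omega then U v else 0.
pose chi v := if v \in Omega then 0 else U v.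
have UE : U = w \+ chi.
  by apply/funext => v; rewrite /= /w /chi; case: ifP; rewrite ?addr0 ?add0r.
have wN v : ~ Omega v -> w v = 0 by move=> nO; rewrite /w memNset.
have w0 : forall x, cl x -> w x = 0.
  apply: flux_pairing_ge0_eq0 => //.
  (* For [x] in [Omega], [flux w x = - flux chi x]; exchanging the sums, the
     pairing becomes a combination of the boundary sums in [e1]. *)
  have -> : \sum_(x <- fset_set cl) w x * flux w x =
      - \sum_(x <- fset_set cl) \sum_(y <- fset_set cl) w x * (mu x y * chi y).
    rewrite -sumrN; apply: eq_bigr => x _; rewrite -mulr_sumr.
    have [Ox|nO] := pselect (Omega x); last by rewrite wN// !mul0r oppr0.
    rewrite -flux_at_zero; last by rewrite /chi mem_set.
    have := hU x Ox; rewrite UE fluxD => /eqP; rewrite addr_eq0 => /eqP ->.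
    by rewrite mulrN.
  rewrite exchange_big big_seq big1 ?oppr0//= => y.
  rewrite in_fset_set; last exact: vclosure_finite.
  move=> /set_mem[Oy|bdy].
    by rewrite big1// => x _; rewrite /chi mem_set// !mulr0.
  transitivity (chi y * \sum_(x <- fset_set cl) mu y x * w x).
    by rewrite mulr_sumr; apply: eq_bigr => x _; rewrite weight_sym; ring.
  suff -> : \sum_(x <- fset_set cl) mu y x * w x = 0 by rewrite mulr0.
  rewrite -(big_fset_set_sub _ _ Omega); first last.
  - by move=> x _ /wN ->; rewrite mulr0.
  - exact: Omega_vclosure.
  - exact: vclosure_finite.
  rewrite -[RHS](e1 y)//; apply: eq_big_seq => x; rewrite in_fset_set// => Ox.
  by rewrite /w Ox.
rewrite psiE; apply/funext => x; rewrite /= /psi.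
have clx := set_valP x; have := w0 _ clx; rewrite /w; case: ifPn => //.
rewrite notin_setE => nO _; have [//|bx] := clx.
pose z : bd := SigSub (mem_set bx).
by rewrite -[val x]/(val z) bU phiE.
Qed.

(** The null-extension vanishes on [Omega], so its flux at [x] reduces to the boundary sum that
    defines [Q]. *)
Lemma null_extension_harmonicP (phi : bd -> R) :
  is_harmonic_extension mu Omega phi (null_extension mu Omega phi) <->
  Qop mu Omega phi = (fun=> 0).
Proof.
have [Phi phiE] := set_type_fun_extends _ _ _ phi.
pose psi v := if v \in Omega then 0 else Phi v.
have psiE : null_extension mu Omega phi = psi \o val := null_extensionE _ _ phiE.
have fluxE x : Omega x -> flux psi x = \sum_(y <- fset_set bd) mu x y * Phi y.
  move=> Ox; rewrite flux_at_zero; last by rewrite /psi mem_set.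
  rewrite -(big_fset_set_sub _ _ bd); first last.
  - by move=> y [Oy|//] _; rewrite /psi mem_set// mulr0.
  - exact: vboundary_vclosure.
  - exact: vclosure_finite.
  apply: eq_big_seq => y; rewrite in_fset_set// => /set_mem[nO _].
  by rewrite /psi memNset.
have QE x : Qop mu Omega phi x =
    (vmeasure mu Omega (val x))^-1 * \sum_(y <- fset_set bd) mu (val x) y * Phi y.
  rewrite /Qop phiE /=.
  have := fsbig_set_type _ _ bd setT (fun y => mu (val x) y * Phi y).
  by rewrite setIT -fsbig_finite// => <-.
split => [[+ _]|Q0].
  rewrite psiE => h; apply/funext => x; have [Ox _] := set_valP x.
  have /laplacian_eq0 := h (SigSub (mem_set Ox)).
  by rewrite /= fluxE// QE => ->; rewrite mulr0.
rewrite psiE; apply/is_harmonic_extensionP; split; last first.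
  by move=> z; rewrite /psi memNset ?phiE//; exact: bd_notin.
move=> x Ox; rewrite fluxE//.
(* [Q] only speaks of the inner boundary; at other vertices of [Omega] all weights to the boundary
   vanish. *)
have [Ix|nI] := pselect (inner_boundary mu Omega x).
  apply/(vmeasure_inv_eq0 x Phi bd) => //; first exact: vboundary_vclosure.
  by have := congr1 (@^~ (SigSub (mem_set Ix))) Q0; rewrite QE.
rewrite big_seq big1// => y; rewrite in_fset_set// => /set_mem bdy.
by rewrite weight_nadj ?mul0r// => xy; apply: nI; split => //; exists y.
Qed.

Lemma Qop_linear : linear (Qop mu Omega :
  (bd -> R^o) -> (inner_boundary mu Omega -> R^o)).
Proof.
move=> c f g; apply/funext => x.
rewrite [RHS]/GRing.add /= [X in _ = X + _]/GRing.scale /= /Qop.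
(* Over an infinite support the sum would default to zero; finiteness of the boundary makes it an
   ordinary sum, hence additive. *)
have fT : finite_set [set: bd] by rewrite (eq_finite_set (card_setT _)).
rewrite !(fsbig_finite _ _ fT).
rewrite /GRing.scale /= mulrCA -mulrDr; congr (_ * _).
rewrite mulr_sumr -big_split; apply: eq_bigr => y _ /=.
by rewrite mulrDr [in LHS]mulrCA.
Qed.

End Graph.

Theorem proposition3p3 (R : realType) (V : countType)
    (mu : weighted_graph R V) (Omega : set V)
    (Omega_finite : finite_set Omega) (Omega_nonempty : Omega !=set0)
    (bd_finite : finite_set (vboundary mu Omega))
    (bd_nonempty : vboundary mu Omega !=set0)
    (conn : tilde_connected mu Omega) :
  (forall phi : vboundary mu Omega -> R,
     E1 mu Omega phi <->
     harmonic_extension mu Omega phi = null_extension mu Omega phi) /\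
  (linear (Qop mu Omega :
     (vboundary mu Omega -> R^o) -> (inner_boundary mu Omega -> R^o)) /\
   E1 mu Omega =
     [set phi : vboundary mu Omega -> R | Qop mu Omega phi = (fun=> 0)]).
Proof.
split; first by move=> phi; exact: E1P.
split; first exact: Qop_linear.
apply/seteqP; split => phi /=.
  move=> /E1P e; apply/null_extension_harmonicP => //.
  by rewrite -e//; exact: harmonic_extension_is_harmonic.
(* Conversely, a harmonic null-extension is the harmonic extension by uniqueness. *)
move=> /null_extension_harmonicP h; apply/E1P => //.
by apply: harmonic_extension_eq => //; exact: h.
Qed.
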